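(* Let $\mathbb{F}$ be a field of characteristic different from $2$ and $3$, let $V$ be a $2$-dimensional $\mathbb{F}$-vector space, and let $q\colon V\to\mathbb{F}$ be a non-degenerate quadratic form which takes the value $-1$. Let $C_0(-q)$ be the even Clifford algebra of $-q$, with conjugation $x\mapsto\bar{x}$ and Clifford norm $N(x)=x\cdot\bar{x}$, and let $G=\{\lambda\in C_0(-q):N(\lambda)=1\}$. Let $(a,c),(a',c')\in C_0(-q)^2$ with $N(c)-N(a)=1$ and $N(c')-N(a')=1$ be such that the symmetric bilinear maps $F_{ac}$ and $F_{a'c'}$, where $F_{ac}(x,y)=a\cdot x\cdot y+c\cdot\overline{x\cdot y}$, belong to the Zariski open subset $R'$ of regular symmetric bilinear maps on $C_0(-q)$. Let $\mathcal{J}_1,\mathcal{J}_2$, $K$, $\mathcal{G}$ and $\mathcal{G}^0$ be as defined in the context. If there exists $\lambda\in G$ such that $(a',c')=(\lambda^{-1}a,\lambda^3c)$ or $(a',c')=(\lambda^{-1}\bar{a},\lambda^3\bar{c})$, then $\mathcal{J}_i(F_{ac})=\mathcal{J}_i(F_{a'c'})$ for $i=1,2$. Therefore, the functions $\mathcal{J}_1$ and $\mathcal{J}_2$ are invariant under the action of the group $\mathcal{G}$. Moreover, the equations $\mathcal{J}_i(F_{ac})=\mathcal{J}_i(F_{a'c'})$, $i=1,2$, hold if and only if the following two conditions are fulfilled: $$\text{(i)}\quad N(a')=N(a),\qquad\qquad \text{(ii)}\quad K(a',c')=K(a,c).$$ In addition, we have the following mutually excluding cases: (1) If $a=0$ and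 (i) and (ii) hold, then $a'=0$, and $F_{ac}$ and $F_{a'c'}$ are $\mathcal{G}$-equivalent if and only if $\frac{c'}{c}$ or $\frac{c'}{\bar{c}}$ is a cube in $C_0(-q)$. (2) If $c=0$ and (i) and (ii) hold, then $c'=0$, and $F_{ac}$ and $F_{a'c'}$ are equivalent under the subgroup $\mathcal{G}^0\subset\mathcal{G}$. (3) If $a\neq 0$ and $c\neq 0$, then (i) and (ii) hold if and only if $F_{ac}$ and $F_{a'c'}$ are $\mathcal{G}$-equivalent.
   Context: Since $q$ is non-degenerate and takes the value $-1$, there is a basis $(v_1,v_2)$ of $V$, orthogonal for the symmetric bilinear form attached to $q$, with $q(v_1)=-1$ and $q(v_2)=-\beta$ for some $\beta\in\mathbb{F}^\ast$. The Clifford algebra $C(-q)$ of $-q$ (in which $v\cdot v=-q(v)$ for $v\in V$) has even part $C_0(-q)=\{x_0+x_{12}(v_1\cdot v_2): x_0,x_{12}\in\mathbb{F}\}$, a commutative $2$-dimensional $\mathbb{F}$-algebra with $(v_1\cdot v_2)^2=-\beta$. Conjugation is $\overline{x_0+x_{12}(v_1\cdot v_2)}=x_0-x_{12}(v_1\cdot v_2)$, and the Clifford norm is $N(x_0+x_{12}(v_1\cdot v_2))=x_0^2+\beta x_{12}^2\in\mathbb{F}$. Regular maps. For a $2$-dimensional $\mathbb{F}$-vector space $W$ and a symmetric bilinear map $F\colon W\times W\to W$, put $F_x(y)=F(x,y)$, $q_F(x)=\det(F_x)$, and let $\operatorname{tr}F\in W^\ast$ be $(\operatorname{tr}F)(x)=\operatorname{tr}(F_x)$.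 For $w^\ast\in W^\ast$ let $\sigma(w^\ast)(x,y)=\frac{1}{3}\left(w^\ast(x)y+w^\ast(y)x\right)$. Then $F$ is called regular if the quadratic form $q_{F^\circ}$ attached to $F^\circ=F-\sigma(\operatorname{tr}F)$ is non-degenerate. $R'$ denotes the set of regular symmetric bilinear maps on $W=C_0(-q)$. Invariants. For $(a,c)\in C_0(-q)^2$ put $K(a,c)=a^3c+\bar{a}^3\bar{c}\in\mathbb{F}$. For $F_{ac}\in R'$ with $N(c)-N(a)=1$, $$\mathcal{J}_1(F_{ac})=27\,\frac{K(a,c)+2N(a)^2+3N(a)}{4K(a,c)+8N(a)^2+36N(a)+27},\qquad \mathcal{J}_2(F_{ac})=27\,\frac{K(a,c)+2N(a)^2}{4K(a,c)+8N(a)^2+36N(a)+27},$$ where the common denominator is non-zero because $F_{ac}\in R'$. Groups. $\mathcal{G}$ is the group (under composition) of the maps $C_0(-q)\to C_0(-q)$ of the form $x\mapsto\lambda x$ or $x\mapsto\lambda\bar{x}$ with $\lambda\in G$; $\mathcal{G}^0\subset\mathcal{G}$ is the subgroup of the maps $x\mapsto\lambda x$ with $\lambda\in G$. The action on symmetric bilinear maps is $(g\cdot F)(x,y)=g(F(g^{-1}(x),g^{-1}(y)))$. Two maps $F,F'$ are $\mathcal{G}$-equivalent (resp. equivalent under $\mathcal{G}^0$) if $F'=g\cdot F$ for some $g\in\mathcal{G}$ (resp. $g\in\mathcal{G}^0$). *)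

(* Defs.v *)
From HB Require Import structures.
From mathcomp Require Import all_boot all_order all_algebra all_field.
From mathcomp Require Import boolp classical_sets.
From mathcomp Require Import ring.

Set Implicit Arguments.
Unset Strict Implicit.
Unset Printing Implicit Defensive.

Import GRing.Theory.

Local Open Scope ring_scope.

Section QuadraticForms.
Context {F : fieldType} {V : vectType F}.
Implicit Types (Q : V -> F) (u v : V).

Definition polar Q u v : F := Q (u + v) - Q u - Q v.

Definition quadratic_form Q : Prop :=
  (forall k v, Q (k *: v) = k ^+ 2 * Q v)
  /\ bilinear_for *%R *%R (polar Q).

Definition nondegenerate_qf Q : Prop :=
  forall u, (forall v, polar Q u v = 0) -> u = 0.

End QuadraticForms.

Section BilinearMaps.
Context {F : fieldType} {W : vectType F}.
Implicit Types (B : W -> W -> W) (g : 'End(W)).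

(* Determinant and trace of an endomorphism, computed in a basis of W. *)
Definition lfdet g : F := \det (passmx.mxof (vbasis fullv) (vbasis fullv) g).
Definition lftr g : F := \tr (passmx.mxof (vbasis fullv) (vbasis fullv) g).

(* [linfun] turns the linear map [B x] into an element of ['End(W)]. *)
Definition qB B (x : W) : F := lfdet (linfun (B x)).
Definition trB B (x : W) : F := lftr (linfun (B x)).

Definition sigma (w : W -> F) (x y : W) : W :=
  3%:R^-1 *: (w x *: y + w y *: x).

Definition Bcirc B (x y : W) : W := B x y - sigma (trB B) x y.

Definition symmetric_bilinear B : Prop :=
  (forall x y, B x y = B y x) /\ bilinear_for *:%R *:%R B.

Definition regular_map B : Prop :=
  symmetric_bilinear B /\ nondegenerate_qf (qB (Bcirc B)).

(* [g^-1%VF] is the inverse of [g] whenever [g] is bijective. *)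
Definition act_map g B : W -> W -> W :=
  fun x y => g (B ((g^-1)%VF x) ((g^-1)%VF y)).

End BilinearMaps.

Section Clifford.
Context {F : fieldType} {V : vectType F} {C : falgType F}.

(* [iota : V -> C] is a Clifford algebra of (V, Q): the universal unital
   F-algebra in which v * v = Q v for all v in V. *)
Definition clifford_algebra (Q : V -> F) (iota : 'Hom(V, C)) : Prop :=
  (forall v, iota v * iota v = (Q v)%:A)
  /\ (forall (A : algType F) (f : {linear V -> A}),
        (forall v, f v * f v = (Q v)%:A) ->
        exists2 phi : {lrmorphism C -> A},
          forall v, phi (iota v) = f v
          & forall psi : {lrmorphism C -> A},
              (forall v, psi (iota v) = f v) -> psi =1 phi).

(* The anti-automorphism of C extending v |-> - v. *)
Definition clifford_conjugation (iota : 'Hom(V, C)) (s : 'End(C)) : Prop :=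
  [/\ s 1 = 1, forall x y, s (x * y) = s y * s x
    & forall v, s (iota v) = - iota v].

(* Spanned by the products of an even number of elements of V. *)
Definition even_part (iota : 'Hom(V, C)) : {aspace C} :=
  <<limg iota * limg iota>>%AS.

End Clifford.

Notation C0 iota := (subvs_of (even_part iota)).

Section EvenClifford.
Context {F : fieldType} {V : vectType F} {C : falgType F}.
Context {iota : 'Hom(V, C)} (s : 'End(C)).
Local Notation W := (C0 iota).
Implicit Types (x y a c l : W) (B : W -> W -> W).

Definition bar x : W := vsproj (even_part iota) (s (vsval x)).

(* [k] if [x = k%:A]; this is only applied to such elements. *)
Definition scalar_part x : F := coord [tuple (1 : W)] ord0 x.

Definition Cnorm x : F := scalar_part (x * bar x).

Definition Kinv a c : F :=
  scalar_part (a ^+ 3 * c + bar a ^+ 3 * bar c).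

Definition Fmap a c x y : W := a * x * y + c * bar (x * y).

(* The pair (a, c) such that B = F_ac; it is unique, see [coefsE]. *)
Definition coefs B : W * W :=
  xget (0, 0) [set p : W * W | B = Fmap p.1 p.2]%classic.

Definition Jden a c : F :=
  4%:R * Kinv a c + 8%:R * Cnorm a ^+ 2 + 36%:R * Cnorm a + 27%:R.

Definition J1 B : F := let: (a, c) := coefs B in
  27%:R * ((Kinv a c + 2%:R * Cnorm a ^+ 2 + 3%:R * Cnorm a) / Jden a c).

Definition J2 B : F := let: (a, c) := coefs B in
  27%:R * ((Kinv a c + 2%:R * Cnorm a ^+ 2) / Jden a c).

(* The maps F_ac for which the invariants J1 and J2 are defined. *)
Definition Jdomain B : Prop :=
  regular_map B /\ exists a c, Cnorm c - Cnorm a = 1 /\ B = Fmap a c.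

Definition calG0 : set 'End(W) :=
  [set g | exists2 l, Cnorm l = 1 & forall x, g x = l * x]%classic.

Definition calG : set 'End(W) :=
  [set g | exists2 l, Cnorm l = 1
    & (forall x, g x = l * x) \/ (forall x, g x = l * bar x)]%classic.

Definition equivalent (H : set 'End(W)) B B' : Prop :=
  exists2 g, H g & B' = act_map g B.

End EvenClifford.

Section OrthogonalBasis.
Context {F : fieldType} {V : vectType F} {C : falgType F}.
Context {q : V -> F} {iota : 'Hom(V, C)} {s : 'End(C)}.
Hypothesis char2 : 2%N \notin [pchar F].
Hypothesis dimV : \dim {:V} = 2%N.
Hypothesis hq : quadratic_form q.
Hypothesis hC : clifford_algebra (fun v => - q v) iota.
Hypothesis hs : clifford_conjugation iota s.
Local Notation W := (C0 iota).

Let two_neq0 : 2%:R != 0 :> F.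
Proof. by move: char2; rewrite inE /=. Qed.

Lemma polarC u v : polar q u v = polar q v u.
Proof. by rewrite /polar [v + u]addrC; ring. Qed.

Lemma polarvv v : polar q v v = 2%:R * q v.
Proof.
have [hZ _] := hq.
by rewrite /polar -[v + v]/(v *+ 2) -scaler_nat hZ; ring.
Qed.

Lemma polarDr u v w : polar q u (v + w) = polar q u v + polar q u w.
Proof.
by have [_ [_ hr]] := hq; have := hr u 1 v w; rewrite scale1r /= mul1r.
Qed.

Lemma polarZr k u v : polar q u (k *: v) = k * polar q u v.
Proof.
have h0 : polar q u 0 = 0 by apply: (@addrI _ (polar q u 0)); rewrite -polarDr !addr0.
by have [_ [_ hr]] := hq; have := hr u k v 0; rewrite addr0 h0 addr0.
Qed.

Lemma orthogonal_basis :
  nondegenerate_qf q -> (exists v, q v = -1) ->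
  exists v1 v2 beta,
    [/\ basis_of fullv [:: v1; v2], polar q v1 v2 = 0,
        q v1 = -1, q v2 = - beta & beta != 0].
Proof.
move=> nd [v1 qv1].
have p11 : polar q v1 v1 = - 2%:R by rewrite polarvv qv1 mulrN1.
have v1n0 : v1 != 0.
  by apply: contra_neq two_neq0 => v10; move: p11; rewrite v10 -(scale0r 0) polarZr mul0r => /eqP; rewrite eq_sym oppr_eq0 => /eqP.
have [w wn] : exists w, w \notin <[v1]>%VS.
  have : ~~ (fullv <= <[v1]>)%VS.
    by apply/negP => /dimvS; rewrite dimV dim_vline v1n0.
  by move/subvPn => [w _ wn]; exists w.
pose v2 := w + (polar q v1 w / 2%:R) *: v1.
have p12 : polar q v1 v2 = 0.
  by rewrite /v2 polarDr polarZr p11; field.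
have v2n : v2 \notin <[v1]>%VS.
  apply: contra wn => h; rewrite -[w](addrK ((polar q v1 w / 2%:R) *: v1)).
  by rewrite rpredB // memvZ // memv_line.
have fr : free [:: v1; v2].
  rewrite (perm_free (_ : perm_eq _ [:: v2; v1])); last by rewrite (perm_catC [:: v1]).
  by rewrite free_cons span_seq1 v2n seq1_free.
have bs : basis_of fullv [:: v1; v2] by rewrite basisEfree fr subvf /= dimV.
exists v1, v2, (- q v2); split; rewrite ?opprK //.
rewrite oppr_eq0; apply/eqP => q2.
have v20 : v2 = 0.
  apply: nd => v; have := memvf v; rewrite -(span_basis bs) span_cons span_seq1.
  case/memv_addP => _ /vlineP[k1 ->] [_ /vlineP[k2 ->] ->].
  by rewrite polarDr !polarZr polarvv q2 polarC p12 !mulr0 addr0.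
by move: v2n; rewrite v20 mem0v.
Qed.

Section Basis.
Variables (v1 v2 : V) (beta : F).
Hypothesis bs : basis_of fullv [:: v1; v2].
Hypothesis p12 : polar q v1 v2 = 0.
Hypothesis qv1 : q v1 = -1.
Hypothesis qv2 : q v2 = - beta.
Hypothesis beta_neq0 : beta != 0.

Let e : W := vsproj (even_part iota) (iota v1 * iota v2).

Let i1 : iota v1 * iota v1 = 1.
Proof. by have [h _] := hC; rewrite h qv1 opprK scale1r. Qed.

Let i2 : iota v2 * iota v2 = beta%:A.
Proof. by have [h _] := hC; rewrite h qv2 opprK. Qed.

Let i21 : iota v2 * iota v1 = - (iota v1 * iota v2).
Proof.
have [h _] := hC; apply/eqP; rewrite -addr_eq0; apply/eqP.
have hp : q (v1 + v2) = q v1 + q v2.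
  by apply/eqP; rewrite -subr_eq0 opprD addrA; apply/eqP.
have := h (v1 + v2); rewrite hp linearD /= mulrDl !mulrDr i1 i2 qv1 qv2.
rewrite opprD !opprK scalerDl scale1r [X in _ + X = _]addrC addrACA.
by rewrite -[RHS]addr0 => /addrI; rewrite addrC.
Qed.

(* The even part is { x0 + x12 (v1 . v2) }. *)
Lemma memC0 (x : C) :
  reflect (exists x0 x12, x = x0%:A + x12 *: (iota v1 * iota v2))
          (x \in even_part iota).
Proof.
pose U := (<[1 : C]> + <[iota v1 * iota v2]>)%VS.
have UP (y : C) : reflect (exists x0 x12, y = x0%:A + x12 *: (iota v1 * iota v2)) (y \in U).
  apply: (iffP memv_addP) => [[_ /vlineP[a ->] [_ /vlineP[b ->] ->]]|[a [b ->]]].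
    by exists a, b.
  by exists a%:A; rewrite ?memvZ ?memv_line //; exists (b *: (iota v1 * iota v2));
    rewrite ?memvZ ?memv_line.
suff -> : even_part iota = U :> {vspace C} by exact: UP.
apply/eqP; rewrite eqEsubv; apply/andP; split.
  apply: agenv_sub_modl; first exact: addvSl.
  have VU : (limg iota * limg iota <= U)%VS.
    apply/prodvP => _ _ /memv_imgP[u _ ->] /memv_imgP[v _ ->].
    have dec z : exists a b, iota z = a *: iota v1 + b *: iota v2.
      have := memvf z; rewrite -(span_basis bs) span_cons span_seq1.
      case/memv_addP => _ /vlineP[a ->] [_ /vlineP[b ->] ->].
      by exists a, b; rewrite linearD !linearZ.
    have [a [b ->]] := dec u; have [a' [b' ->]] := dec v.
    apply/UP; exists (a * a' + b * b' * beta), (a * b' - b * a').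
    rewrite mulrDl !mulrDr -!scalerAl -!scalerAr i1 i2 i21 scalerN !scalerA.
    rewrite [X in _ + X]addrC addrACA -scalerDl -scaleNr.
    by rewrite scalerA mulrN -scalerDl.
  apply: subv_trans (_ : (U * U <= U)%VS); first exact: prodvSl.
  apply/prodvP => _ _ /UP[a [b ->]] /UP[a' [b' ->]]; apply/UP.
  exists (a * a' - b * b' * beta), (a * b' + b * a').
  rewrite mulrDl !mulrDr -!scalerAl -!scalerAr !mul1r mulr1 !scalerA.
  have -> : iota v1 * iota v2 * (iota v1 * iota v2) = (- beta)%:A.
    by rewrite mulrA -[_ * _ * iota v1]mulrA i21 mulrN mulNr mulrA i1 mul1r i2 scaleNr.
  by rewrite scalerA mulrN [X in _ + X]addrC addrACA -!scalerDl.
apply/subvP => _ /UP[a [b ->]]; rewrite memvD ?memvZ //.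
  by rewrite memvE sub1_agenv.
by apply: (subvP (sub_agenv _)); rewrite memv_mul // memv_img ?memvf.
Qed.

Lemma q_basis x y : q (x *: v1 + y *: v2) = - (x ^+ 2 + beta * y ^+ 2).
Proof.
have [hZ _] := hq.
have : polar q (x *: v1) (y *: v2) = 0.
  by rewrite polarZr polarC polarZr polarC p12 !mulr0.
rewrite /polar -addrA -opprD => /subr0_eq ->.
by rewrite !hZ qv1 qv2; ring.
Qed.

(* 1 and v1 . v2 are linearly independent: map C to 'M[F]_2. *)
Lemma freeC0 (x0 x12 : F) :
  x0%:A + x12 *: (iota v1 * iota v2) = 0 -> x0 = 0 /\ x12 = 0.
Proof.
have [_ univ] := hC.
pose D x y : 'M[F]_2 := \matrix_(i, j)
  (if i == 0 then if j == 0 then x else beta * y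
   else if j == 0 then y else - x).
pose b := [tuple v1; v2].
pose f0 v := D (coord b 0 v) (coord b 1 v).
have f0_lin : linear f0.
  move=> k u v; apply/matrixP => i j; rewrite /f0 !linearP !mxE.
  by do 2!case: ifP => _; rewrite /=; ring.
pose f0M := GRing.isLinear.Build _ _ _ _ f0 f0_lin.
pose f : {linear V -> 'M[F]_2} := HB.pack f0 f0M.
have bb : basis_of fullv b by [].
have cb x y : f (x *: v1 + y *: v2) = D x y.
  have fb := basis_free bb.
  have -> : x *: v1 + y *: v2 = \sum_(i < 2) (if i == 0 then x else y) *: b`_i.
    by rewrite big_ord_recl big_ord1.
  by rewrite /= /f0 !coord_sum_free.
have [|phi hphi _] := univ _ f.
  move=> v; have -> : v = coord b 0 v *: v1 + coord b 1 v *: v2.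
    rewrite {1}(coord_basis bb (memvf v)) big_ord_recl big_ord1 /=.
    by congr (_ + coord _ _ _ *: _); apply: val_inj.
  rewrite cb q_basis opprK; apply/matrixP => i j.
  rewrite !mxE big_ord_recl big_ord1 !mxE /=.
  have [-> | ->] : i = 0 \/ i = 1 by case: i => [[|[|]]] //= ?; [left|right]; apply: val_inj.
    have [-> | ->] : j = 0 \/ j = 1 by case: j => [[|[|]]] //= ?; [left|right]; apply: val_inj.
      by rewrite /=; ring.
    by rewrite /=; ring.
  have [-> | ->] : j = 0 \/ j = 1 by case: j => [[|[|]]] //= ?; [left|right]; apply: val_inj.
    by rewrite /=; ring.
  by rewrite /=; ring.
move/(congr1 phi); rewrite rmorph0 linearD !linearZ /= rmorph1 rmorphM /= !hphi.
have -> : f v1 = D 1 0 by rewrite -cb scale1r scale0r addr0.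
have -> : f v2 = D 0 1 by rewrite -cb scale1r scale0r add0r.
move=> /matrixP h; have := h 0 0; have := h 1 0.
rewrite !mxE !big_ord_recl !big_ord0 !mxE /= => h1 h2.
by split; [rewrite -[RHS]h2 | apply: oppr_inj; rewrite oppr0 -[RHS]h1]; ring.
Qed.

Let val1 : vsval (1 : W) = 1.
Proof. by apply/eqP; rewrite /= algid_eq1 memvE sub1_agenv. Qed.

Let valM (x y : W) : vsval (x * y) = vsval x * vsval y.
Proof. by []. Qed.

Let vale : vsval e = iota v1 * iota v2.
Proof.
by rewrite vsprojK //; apply/memC0; exists 0, 1; rewrite scale0r add0r scale1r.
Qed.

Let valE x0 x12 :
  vsval (x0%:A + x12 *: e) = x0%:A + x12 *: (iota v1 * iota v2).
Proof.
by rewrite linearD 2!linearZ; congr (_ *: _ + _ *: _); [exact: val1 | exact: vale].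
Qed.

Lemma C0P (x : W) : exists x0 x12, x = x0%:A + x12 *: e.
Proof.
have /memC0[x0 [x12 hx]] := subvsP x; exists x0, x12.
by apply: subvs_inj; rewrite valE.
Qed.

Lemma e_sqr : e * e = (- beta)%:A.
Proof.
rewrite -[RHS]addr0 -[X in _ + X](scale0r e).
apply: subvs_inj; rewrite valE scale0r addr0 valM vale.
by rewrite mulrA -[_ * _ * iota v1]mulrA i21 mulrN mulNr mulrA i1 mul1r i2 scaleNr.
Qed.

Lemma barE x0 x12 : bar s (x0%:A + x12 *: e) = x0%:A - x12 *: e.
Proof.
have [s1 sM si] := hs; rewrite -scaleNr; apply: subvs_inj; rewrite /bar !valE.
rewrite linearD !linearZ /= s1 sM !si mulrNN i21 scalerN -scaleNr vsprojK //.
by apply/memC0; exists x0, (- x12).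
Qed.

Lemma scalar_partE k : scalar_part (k%:A : W) = k.
Proof.
have fr : free [tuple (1 : W)] by rewrite seq1_free oner_eq0.
by rewrite /scalar_part linearZ /= (coord_free 0 0 fr) eqxx mulr1.
Qed.

Lemma C0M x0 x12 y0 y12 :
  (x0%:A + x12 *: e) * (y0%:A + y12 *: e)
  = (x0 * y0 - beta * (x12 * y12))%:A + (x0 * y12 + x12 * y0) *: e.
Proof.
rewrite mulrDl !mulrDr -!scalerAl -!scalerAr !mul1r mulr1 e_sqr !scalerA.
by rewrite mulrN [X in _ + X]addrC addrACA -!scalerDl [beta * _]mulrC.
Qed.

Lemma CnormE x0 x12 : Cnorm s (x0%:A + x12 *: e) = x0 ^+ 2 + beta * x12 ^+ 2.
Proof.
rewrite /Cnorm barE -scaleNr C0M (_ : x0 * - x12 + _ = 0); last by ring.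
by rewrite scale0r addr0 scalar_partE; ring.
Qed.

Lemma Cnorm_alg (x : W) : (Cnorm s x)%:A = x * bar s x.
Proof.
have [x0 [x12 ->]] := C0P x; rewrite CnormE barE -scaleNr C0M.
rewrite (_ : x0 * - x12 + _ = 0); last by ring.
by rewrite scale0r addr0; congr (_ *: _); ring.
Qed.

Lemma Kinv_alg (a c : W) : (Kinv s a c)%:A = a ^+ 3 * c + bar s a ^+ 3 * bar s c.
Proof.
have [[a0 [a12 ->]] [c0 [c12 ->]]] := (C0P a, C0P c).
rewrite /Kinv !barE -!scaleNr !exprS expr0 !mulr1 !C0M addrACA -!scalerDl.
set z := (X in X *: e); have -> : z = 0 by rewrite /z; ring.
by rewrite scale0r addr0 scalar_partE.
Qed.

Lemma coefsE (a c : W) : coefs s (Fmap s a c) = (a, c).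
Proof.
have b1 : bar s (1 : W) = 1.
  by have := barE 1 0; rewrite scale0r subr0 addr0 scale1r.
have be : bar s e = - e.
  by have := barE 0 1; rewrite scale0r !add0r scale1r.
have eI0 (x : W) : x * e = 0 -> x = 0.
  move=> /(congr1 (fun z => z * e)); rewrite mul0r -mulrA e_sqr -scalerAr mulr1.
  by move=> /eqP; rewrite scaler_eq0 oppr_eq0 (negPf beta_neq0) => /eqP.
apply: xget_unique => // -[a' c'] /= eqF.
have h1 : a + c = a' + c'.
  by have := congr1 (fun B => B 1 1) eqF; rewrite /Fmap !mulr1 b1 !mulr1.
have h2 : a - c = a' - c'.
  have := congr1 (fun B => B 1 e) eqF; rewrite /Fmap !mulr1 mul1r be !mulrN.
  by rewrite -!mulrBl => /eqP; rewrite -subr_eq0 -mulrBl => /eqP/eI0/subr0_eq.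
have dbl (x y : W) : x + y + (x - y) = 2%:R *: x.
  by rewrite addrACA subrr addr0 scaler_nat.
have ha : a' = a.
  apply: (scalerI two_neq0); rewrite -(dbl a' c') -(dbl a c) h1 h2 //.
by rewrite ha; congr (_, _); move: h1; rewrite ha => /addrI.
Qed.

Lemma J1E (a c : W) :
  J1 s (Fmap s a c)
  = 27%:R * ((Kinv s a c + 2%:R * Cnorm s a ^+ 2 + 3%:R * Cnorm s a) / Jden s a c).
Proof. by rewrite /J1 coefsE. Qed.

Lemma J2E (a c : W) :
  J2 s (Fmap s a c) = 27%:R * ((Kinv s a c + 2%:R * Cnorm s a ^+ 2) / Jden s a c).
Proof. by rewrite /J2 coefsE. Qed.

End Basis.
End OrthogonalBasis.

(* Main.v *)
From HB Require Import structures.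
Require Import Defs.
From mathcomp Require Import all_boot all_order all_algebra all_field.
From mathcomp Require Import boolp classical_sets.
From mathcomp Require Import ring.

Set Implicit Arguments.
Unset Strict Implicit.
Unset Printing Implicit Defensive.

Import GRing.Theory.

Local Open Scope ring_scope.

(** Identify F_ac with the pair (a, c): the maps x |-> l x and x |-> l bar x with
    N(l) = 1 act on pairs by (a, c) |-> (l^-1 a, l^3 c), preceded by conjugation
    for the second kind (act_mul, act_mul_bar). Both N(a) and y = a^3 c are
    unchanged by the first kind of map, and the second kind conjugates y. Hence
    N(a) and the trace K(a, c) of y are invariants, and so are J1 and J2, which
    are functions of them.

    Conversely, N(a) gives N(c) = N(a) + 1, so N(a) and K(a, c) give the norm and
    the trace of y. These determine y up to conjugation (trace_norm_conj), and
    after a conjugation a'^3 c' = a^3 c. If N(a) != 0, then l = a / a' maps (a, c)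
    to (a', c'). If N(a) = 0 and a != 0, the algebra is the split one F x F and a
    lies on one of its two factors; there l is found factor by factor
    (twist_null). So only a = 0 is left out: then c and c' are any elements of
    norm one, and equivalence asks for c' / c or c' / bar c to be the cube of an
    element of norm one. A cube m^3 of norm one is always such a cube, namely
    that of N(m) m, because N(m) is then a cube root of unity (norm1_cube).

    J1 and J2 in turn determine N(a) and K(a, c), by linear algebra
    (J_separates), as soon as their denominators are non-zero. This is where
    regularity comes in: the discriminant of the binary form attached to
    the traceless part of F_ac is, up to a non-zero factor, the common denominator
    (qB_Bcirc_form, regular_Fmap).

    C0 is given as a subalgebra of a noncommutative algebra. The arguments about norms, traces and cubes are
    therefore made for a commutative ring A generated over F by an element e with
    e^2 = - beta, and then applied to C0 once it is known to be commutative. *)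

(** * Quadratic algebras *)

Section QuadraticAlgebra.
Context {F : fieldType} {A : comUnitRingType} (i : {rmorphism F -> A}).
Context (conj : {rmorphism A -> A}) (e : A) (beta : F) (N : A -> F).
Hypothesis two_neq0 : 2%:R != 0 :> F.
Hypothesis beta_neq0 : beta != 0.
Hypothesis eK : e * e = i (- beta).
Hypothesis span1e : forall x, exists x0 x1, x = i x0 + i x1 * e.
Hypothesis conj_scalar : forall k, conj (i k) = i k.
Hypothesis conj_e : conj e = - e.
Hypothesis normE : forall x, i (N x) = x * conj x.

Lemma conjK : involutive conj.
Proof.
move=> x; have [x0 [x1 ->]] := span1e x.
by rewrite !(rmorphD, rmorphM, rmorphN, conj_scalar, conj_e) opprK.
Qed.

Lemma normM x y : N (x * y) = N x * N y.
Proof. by apply: (fmorph_inj i); rewrite rmorphM !normE rmorphM; ring. Qed.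

Lemma norm_conj x : N (conj x) = N x.
Proof. by apply: (fmorph_inj i); rewrite !normE conjK mulrC. Qed.

Lemma norm_scalar k : N (i k) = k ^+ 2.
Proof. by apply: (fmorph_inj i); rewrite normE conj_scalar rmorphXn. Qed.

Lemma norm1 : N 1 = 1.
Proof. by rewrite -(rmorph1 i) norm_scalar expr1n. Qed.

Lemma norm0 : N 0 = 0.
Proof. by rewrite -(rmorph0 i) norm_scalar expr0n. Qed.

Lemma normX x n : N (x ^+ n) = N x ^+ n.
Proof. by elim: n => [|n IHn]; rewrite ?norm1 // !exprS normM IHn. Qed.

Lemma unit_of_norm x : N x != 0 -> x \is a GRing.unit.
Proof.
move=> Nx; apply/unitrPr; exists (conj x * i (N x)^-1).
by rewrite mulrA -normE -rmorphM mulfV ?rmorph1.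
Qed.

Lemma unit_of_norm1 x : N x = 1 -> x \is a GRing.unit.
Proof. by move=> Nx; rewrite unit_of_norm ?Nx ?oner_eq0. Qed.

Lemma norm1_inv x : N x = 1 -> x^-1 = conj x.
Proof.
move=> Nx; apply: (mulrI (unit_of_norm1 Nx)).
by rewrite divrr ?unit_of_norm1 // -normE Nx rmorph1.
Qed.

Lemma normV x : N x != 0 -> N x^-1 = (N x)^-1.
Proof.
move=> Nx; apply: (mulfI Nx).
by rewrite mulfV // -normM mulrV ?unit_of_norm ?norm1.
Qed.

Lemma conj_coord x0 x1 : conj (i x0 + i x1 * e) = i x0 - i x1 * e.
Proof. by rewrite !(rmorphD, rmorphM, conj_scalar, conj_e) mulrN. Qed.

Lemma trace_coord x0 x1 :
  i x0 + i x1 * e + conj (i x0 + i x1 * e) = i (2%:R * x0).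
Proof. by rewrite conj_coord rmorphM /= rmorph_nat; ring. Qed.

Lemma norm_coord x0 x1 : N (i x0 + i x1 * e) = x0 ^+ 2 + beta * x1 ^+ 2.
Proof.
apply: (fmorph_inj i); rewrite normE conj_coord.
have -> : (i x0 + i x1 * e) * (i x0 - i x1 * e) = i x0 ^+ 2 - i x1 ^+ 2 * (e * e).
  by ring.
by rewrite eK; ring.
Qed.

Lemma trace_scalar x : exists t, x + conj x = i t.
Proof.
by have [x0 [x1 ->]] := span1e x; exists (2%:R * x0); rewrite trace_coord.
Qed.

(** A root in A of the characteristic polynomial of y can only be y or its
    conjugate: with zero divisors around this is not a matter of factoring the
    polynomial, but the trace fixes the scalar coordinate and the norm then
    fixes the square of the other one. *)
Lemma trace_norm_conj y z :
  z + conj z = y + conj y -> N z = N y -> z = y \/ z = conj y.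
Proof.
have [y0 [y1 ->]] := span1e y; have [z0 [z1 ->]] := span1e z.
rewrite !trace_coord !norm_coord conj_coord => /(fmorph_inj i)/(mulfI two_neq0) ->.
move=> /addrI/(mulfI beta_neq0).
by move/eqP; rewrite eqf_sqr => /orP[] /eqP ->; [left|right] => //; rewrite rmorphN mulNr.
Qed.

Lemma sqr_null a t : N a = 0 -> a + conj a = i t -> a * a = i t * a.
Proof. by move=> Na <-; rewrite mulrDl [_ * a]mulrC [conj a * a]mulrC -normE Na rmorph0 addr0. Qed.

(** A null element of trace zero has square zero, and the algebra is reduced. *)
Lemma trace_null_neq0 a t : N a = 0 -> a + conj a = i t -> a != 0 -> t != 0.
Proof.
move=> Na Ta; apply: contra_neq => t0; have [] := @trace_norm_conj 0 a.
- by rewrite Ta t0 !rmorph0 addr0.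
- by rewrite Na norm0.
- by [].
- by rewrite rmorph0.
Qed.

Lemma scalarI t : t != 0 -> injective ( *%R (i t)).
Proof. by move=> t0; apply/mulrI/(rmorph_unit i); rewrite unitfE. Qed.

(** Null elements a and a' lie on the same factor of the split algebra exactly
    when a' bar a = 0; here both lines contain the non-zero element a^3 c. *)
Lemma null_conj_mul (a c a' c' : A) :
  N a = 0 -> N a' = 0 -> N c' = 1 -> a' != 0 ->
  a' ^+ 3 * c' = a ^+ 3 * c -> a' * conj a = 0.
Proof.
move=> Na Na' Nc' a'0 eqy; have [t' Ta'] := trace_scalar a'.
have t'0 := trace_null_neq0 Na' Ta' a'0.
apply/(scalarI t'0)/(scalarI t'0)/(mulIr (unit_of_norm1 Nc')).
have -> : i t' * (i t' * (a' * conj a)) * c' = i t' * (i t' * a') * c' * conj a.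
  by ring.
rewrite -(sqr_null Na' Ta') mulrA -(sqr_null Na' Ta').
have -> : a' * a' * a' * c' * conj a = a' ^+ 3 * c' * conj a by ring.
rewrite eqy.
have -> : a ^+ 3 * c * conj a = a ^+ 2 * c * (a * conj a) by ring.
by rewrite -normE Na rmorph0 !mulr0 mul0r.
Qed.

(** When a is null, A is split and a spans the line of an idempotent eps; then a'
    is on the same line, a' = t a, and the l sought is diagonal in the
    decomposition 1 = eps + conj eps: it must be 1/t on the first factor to send
    a to a', and norm one forces t on the second. *)
Lemma twist_null (a c a' c' : A) :
  N a = 0 -> N a' = 0 -> N c = 1 -> N c' = 1 -> a != 0 -> a' != 0 ->
  a' ^+ 3 * c' = a ^+ 3 * c ->
  exists2 l, N l = 1 & (a', c') = (l^-1 * a, l ^+ 3 * c).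
Proof.
move=> Na Na' Nc Nc' a0 a'0 eqy.
have [T TE] := trace_scalar a; have [T' T'E] := trace_scalar a'.
have T0 := trace_null_neq0 Na TE a0; have T'0 := trace_null_neq0 Na' T'E a'0.
have a'a0 := null_conj_mul Na Na' Nc' a'0 eqy.
have aa'0 : conj a' * a = 0 by rewrite -[a]conjK -rmorphM a'a0 rmorph0.
(* Comparing traces, the ratio t = a' / a can only be T' / T. *)
pose u := i (T' / T); pose v := i (T / T'); pose eps := i T^-1 * a.
have uv : u * v = 1 by rewrite /u /v -rmorphM mulrA divfK // mulfV ?rmorph1.
have aE : a = i T * eps by rewrite /eps mulrA -rmorphM mulfV // rmorph1 mul1r.
have epseps : eps * eps = eps.
  rewrite /eps mulrACA (sqr_null Na TE) mulrA -!rmorphM.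
  by rewrite -mulrA mulVf // mulr1.
have conj_eps : conj eps = 1 - eps.
  apply/eqP; rewrite eq_sym subr_eq addrC /eps rmorphM conj_scalar -mulrDr TE.
  by rewrite -rmorphM mulVf ?rmorph1.
have a'E : a' = u * a.
  apply: (scalarI T0); rewrite mulrA -rmorphM [T * _]mulrC divfK // -T'E -TE.
  by rewrite !mulrDl aa'0 [conj a * _]mulrC a'a0 mulrC.
have conj_u : conj u = u by rewrite conj_scalar.
have conj_v : conj v = v by rewrite conj_scalar.
clearbody u v eps.
have cubeE : eps * c = u ^+ 3 * (eps * c').
  apply: (scalarI T0); apply: (scalarI T0); apply: (scalarI T0).
  move: eqy; rewrite a'E aE.
  have eps3 : eps ^+ 3 = eps by rewrite !exprS expr0 mulr1 !epseps.
  rewrite !exprMn eps3 => eqy.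
  rewrite !mulrA in eqy *; rewrite -!expr2 -exprSr.
  by rewrite -eqy; ring.
have conj_cube : (1 - eps) * c' = u ^+ 3 * ((1 - eps) * c).
  have cc : c * conj c = 1 by rewrite -normE Nc rmorph1.
  have c'c' : c' * conj c' = 1 by rewrite -normE Nc' rmorph1.
  have := congr1 conj cubeE.
  rewrite !(rmorphM, rmorphXn) conj_eps /= conj_u => eqc.
  have -> : (1 - eps) * c' = (1 - eps) * conj c * (c * c').
    by rewrite -[LHS]mulr1 -cc; ring.
  rewrite eqc -[RHS]mulr1 -c'c'; ring.
pose l := v * eps + u * (1 - eps).
have Nl : N l = 1.
  apply: (fmorph_inj i); rewrite normE rmorph1 /l.
  rewrite !(rmorphD, rmorphM, rmorphN, rmorph1, conj_u, conj_v, conj_scalar) conj_eps.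
  rewrite opprB addrCA subrr addr0.
  by ring: uv epseps.
exists l => //; congr (_, _).
- rewrite norm1_inv // a'E /l.
  rewrite !(rmorphD, rmorphM, rmorphN, rmorph1, conj_u, conj_v, conj_scalar) conj_eps.
  by rewrite aE; ring: uv epseps.
- have -> : l ^+ 3 = v ^+ 3 * eps + u ^+ 3 * (1 - eps).
    by rewrite /l; ring: uv epseps.
  have vu3 : v ^+ 3 * u ^+ 3 = 1 by rewrite -exprMn mulrC uv expr1n.
  rewrite mulrDl -[u ^+ 3 * _ * c]mulrA -conj_cube -mulrA cubeE mulrA vu3; ring.
Qed.

Lemma cube_eq0 (a : A) : a ^+ 3 = 0 -> a = 0.
Proof.
move=> a30; have /eqP : N a ^+ 3 = 0 by rewrite -normX a30 norm0.
rewrite expf_eq0 => /andP[_ /eqP Na]; have [t Ta] := trace_scalar a.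
apply/eqP/negPn/negP => a0; have t0 := trace_null_neq0 Na Ta a0.
move/eqP: a0; apply; apply/(scalarI t0)/(scalarI t0).
by rewrite -(sqr_null Na Ta) mulrA -(sqr_null Na Ta) !mulr0 -a30 !exprS mulr1 mulrA.
Qed.

(** When a is invertible, l = a / a' is forced, and its cube is c' / c because
    a'^3 c' = a^3 c. *)
Lemma twist_of_cube (a c a' c' : A) :
  N c - N a = 1 -> N c' - N a' = 1 -> N a' = N a -> a != 0 ->
  a' ^+ 3 * c' = a ^+ 3 * c ->
  exists2 l, N l = 1 & (a', c') = (l^-1 * a, l ^+ 3 * c).
Proof.
move=> hac hac' Naa' a0 eqy; have [Na | Na] := eqVneq (N a) 0.
  have Nc : N c = 1 by rewrite -hac Na subr0.
  have Nc' : N c' = 1 by rewrite -hac' Naa' Na subr0.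
  apply: twist_null; rewrite ?Naa' //.
  apply: contra_neq a0 => a'0; apply: cube_eq0.
  apply: (mulIr (unit_of_norm1 Nc)).
  by rewrite -eqy a'0 expr0n !mul0r.
have Na' : N a' != 0 by rewrite Naa'.
have [ua ua'] := (unit_of_norm Na, unit_of_norm Na').
exists (a / a'); first by rewrite normM normV // Naa' mulfV.
rewrite invrM ?unitrV // invrK divrK // exprMn exprVn; congr (_, _).
by rewrite mulrAC -eqy mulrAC mulrV ?unitrX ?mul1r.
Qed.

Context (K : A -> A -> F).
Hypothesis KE : forall a c, i (K a c) = a ^+ 3 * c + conj a ^+ 3 * conj c.

Lemma K_conj a c : K (conj a) (conj c) = K a c.
Proof. by apply: (fmorph_inj i); rewrite !KE !conjK addrC. Qed.

Lemma K_twist l a c : N l = 1 -> K (l^-1 * a) (l ^+ 3 * c) = K a c.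
Proof.
move=> Nl; have ul := unit_of_norm1 Nl; apply: (fmorph_inj i).
have twist x y : (l^-1 * x) ^+ 3 * (l ^+ 3 * y) = x ^+ 3 * y.
  by rewrite exprMn mulrACA -exprMn mulVr // expr1n mul1r.
by rewrite !KE -!rmorphXn -!rmorphM twist.
Qed.

Lemma norm_twist l n a : N l = 1 -> N (l^-1 * a) = N a /\ N (l ^+ n * a) = N a.
Proof.
move=> Nl; rewrite !normM normX normV Nl ?oner_eq0 //.
by rewrite invr1 expr1n !mul1r.
Qed.

(** N(a) and K(a, c) are, through the relation N(c) - N(a) = 1, the norm and
    trace of a^3 c, so they determine this element up to conjugation; and a^3 c
    is invariant under (a, c) |-> (a / l, l^3 c). *)
Lemma twist_of_norm_K (a c a' c' : A) :
  N c - N a = 1 -> N c' - N a' = 1 -> a != 0 -> N a' = N a -> K a' c' = K a c ->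
  exists2 l, N l = 1
    & (a', c') = (l^-1 * a, l ^+ 3 * c)
      \/ (a', c') = (l^-1 * conj a, l ^+ 3 * conj c).
Proof.
move=> hac hac' a0 Naa' /(congr1 i); rewrite !KE -!rmorphXn -!rmorphM => Tr.
have Ncc' : N c' = N c by rewrite -[LHS](subrK (N a')) hac' -hac Naa' subrK.
have Nrm : N (a' ^+ 3 * c') = N (a ^+ 3 * c) by rewrite normM [RHS]normM !normX Naa' Ncc'.
have [eqy|eqy] := trace_norm_conj Tr Nrm.
  by have [l Nl eql] := twist_of_cube hac hac' Naa' a0 eqy; exists l => //; left.
rewrite rmorphM rmorphXn in eqy.
have ca0 : conj a != 0 by apply: contra_neq a0 => ca0; rewrite -[a]conjK ca0 rmorph0.
have cac : N (conj c) - N (conj a) = 1 by rewrite !norm_conj.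
have cNa : N a' = N (conj a) by rewrite norm_conj.
have [l Nl eql] := twist_of_cube cac hac' cNa ca0 eqy.
by exists l => //; right.
Qed.

(** The norm of m is a cube root of unity, so multiplying m by it changes the
    norm but not the cube. *)
Lemma norm1_cube m : N (m ^+ 3) = 1 -> exists2 l, N l = 1 & l ^+ 3 = m ^+ 3.
Proof.
rewrite normX => Nm; exists (i (N m) * m).
  by rewrite normM norm_scalar -exprSr.
by rewrite exprMn -rmorphXn /= Nm rmorph1 mul1r.
Qed.

Lemma norm1_ratio_cube (c c' : A) : N c = 1 -> N c' = 1 ->
  (exists2 l, N l = 1 & c' = l ^+ 3 * c) <-> (exists m, c' / c = m ^+ 3).
Proof.
move=> Nc Nc'; have uc := unit_of_norm1 Nc; split=> [[l _ ->]|[m eqm]].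
  by exists l; rewrite mulrK.
have [|l Nl eql] := @norm1_cube m.
  by rewrite -eqm normM normV Nc ?oner_eq0 // Nc' divr1.
by exists l; rewrite // eql -eqm divrK.
Qed.

End QuadraticAlgebra.

(** * Determinant and trace of a plane endomorphism *)

Section PlaneEndomorphisms.
Context {F : fieldType} {W : vectType F}.

(** lfdet and lftr are computed in one particular basis of W; as a change of
    basis is a conjugation, any other basis will do. *)
Lemma lfdet_lftr_basis n (b : n.-tuple W) (g : 'End(W)) :
  basis_of fullv b ->
  let M := \matrix_(i < n, j < n) coord b j (g b`_i) in
  lfdet g = \det M /\ lftr g = \tr M.
Proof.
move=> bb; have dn := size_basis bb; subst n => /=; set M := \matrix_(_, _) _.
have -> : M = passmx.mxof b b g.
  by apply/matrixP => k j; rewrite !mxE /= passmx.vecof_delta.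
pose v := vbasis {:W}; have vb : basis_of fullv v := vbasisP _.
have idb : passmx.mxof v b \1 *m passmx.mxof b v \1 = 1%:M.
  by rewrite -(passmx.mxof_comp _ _ bb) comp_lfun1l passmx.mxof1 ?(basis_free vb).
have gE : passmx.mxof v v g
          = passmx.mxof v b \1 *m passmx.mxof b b g *m passmx.mxof b v \1.
  by rewrite -!(passmx.mxof_comp _ _ bb) comp_lfun1l comp_lfun1r.
rewrite /lfdet /lftr gE; split; last first.
  by rewrite mxtrace_mulC mulmxA (mulmx1C idb) mul1mx.
by rewrite !det_mulmx mulrAC -det_mulmx idb det1 mul1r.
Qed.

Lemma lfdet_lftr_plane (b : 2.-tuple W) (g : 'End(W)) (x y z t : F) :
  basis_of fullv b ->
  g b`_0 = x *: b`_0 + y *: b`_1 -> g b`_1 = z *: b`_0 + t *: b`_1 ->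
  lfdet g = x * t - y * z /\ lftr g = x + t.
Proof.
move=> bb g0 g1; have [-> ->] := lfdet_lftr_basis g bb.
have crd (j : 'I_2) u w :
    coord b j (u *: b`_0 + w *: b`_1) = if j == 0 then u else w.
  have -> : u *: b`_0 + w *: b`_1 = \sum_(k < 2) (if k == 0 then u else w) *: b`_k.
    by rewrite big_ord_recl big_ord1.
  by rewrite coord_sum_free ?(basis_free bb).
rewrite (expand_det_row _ 0) /mxtrace !big_ord_recl !big_ord0 /cofactor.
rewrite !det_mx11 !mxE /= g0 g1 !crd /= addr0.
by split; ring.
Qed.

End PlaneEndomorphisms.

(** * Binary quadratic forms *)

Section BinaryForms.
Context {F : fieldType} {W : vectType F} (b0 b1 : W) (Q : W -> F) (p r t : F).
Hypothesis span_b : forall x, exists x0 x1, x = x0 *: b0 + x1 *: b1.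
Hypothesis free_b :
  forall x0 x1, x0 *: b0 + x1 *: b1 = 0 -> x0 = 0 /\ x1 = 0.
Hypothesis QE : forall x0 x1,
  Q (x0 *: b0 + x1 *: b1) = p * x0 ^+ 2 + r * (x0 * x1) + t * x1 ^+ 2.

Lemma polar_plane x0 x1 y0 y1 :
  polar Q (x0 *: b0 + x1 *: b1) (y0 *: b0 + y1 *: b1)
  = (2%:R * p * x0 + r * x1) * y0 + (r * x0 + 2%:R * t * x1) * y1.
Proof.
by rewrite /polar addrACA -!scalerDl !QE; ring.
Qed.

Lemma nondegenerate_plane :
  nondegenerate_qf Q <-> r ^+ 2 - 4%:R * (p * t) != 0.
Proof.
split=> [nd|disc0 u]; last first.
  have [u0 [u1 ->]] := span_b u => polar0.
  have := polar0 (1 *: b0 + 0 *: b1); have := polar0 (0 *: b0 + 1 *: b1).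
  rewrite !polar_plane !mulr0 !mulr1 addr0 add0r => eq1 eq0.
  have u00 : u0 = 0.
    apply: (mulfI disc0); rewrite mulr0.
    have -> : (r ^+ 2 - 4%:R * (p * t)) * u0
      = r * (r * u0 + 2%:R * t * u1) - 2%:R * t * (2%:R * p * u0 + r * u1) by ring.
    by rewrite eq0 eq1 !mulr0 subr0.
  have u10 : u1 = 0.
    apply: (mulfI disc0); rewrite mulr0.
    have -> : (r ^+ 2 - 4%:R * (p * t)) * u1
      = r * (2%:R * p * u0 + r * u1) - 2%:R * p * (r * u0 + 2%:R * t * u1) by ring.
    by rewrite eq0 eq1 !mulr0 subr0.
  by rewrite u00 u10 !scale0r addr0.
apply/eqP => disc.
have kernel u0 u1 : 2%:R * p * u0 + r * u1 = 0 -> r * u0 + 2%:R * t * u1 = 0 ->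
    u0 = 0 /\ u1 = 0.
  move=> eq0 eq1; apply/free_b/nd => v; have [y0 [y1 ->]] := span_b v.
  by rewrite polar_plane eq0 eq1 !mul0r addr0.
(* These are the rows of the Gram matrix, rotated by a quarter turn: its
   determinant vanishing, they are in its kernel. *)
have [] := kernel r (- (2%:R * p)); [ring | by rewrite -[RHS]disc; ring | move=> r0 p0].
have [] := kernel (- (2%:R * t)) r; [by rewrite -[RHS]disc; ring | ring | move=> t0 _].
have [] := kernel 1 0.
- by rewrite mulr1 mulr0 addr0 -[RHS]oppr0 -p0 opprK.
- by rewrite r0 !mulr0 mulr1 addr0.
by move/eqP; rewrite oner_eq0.
Qed.

End BinaryForms.

(** * The even Clifford algebra *)

Section EvenClifford.
Context {F : fieldType} {V : vectType F} {C : falgType F}.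
Context {q : V -> F} {iota : 'Hom(V, C)} {s : 'End(C)}.
Context (v1 v2 : V) (beta : F).
Hypothesis char2 : 2%N \notin [pchar F].
Hypothesis char3 : 3%N \notin [pchar F].
Hypothesis hC : clifford_algebra (fun v => - q v) iota.
Hypothesis hs : clifford_conjugation iota s.
Hypothesis bs : basis_of fullv [:: v1; v2].
Hypothesis p12 : polar q v1 v2 = 0.
Hypothesis qv1 : q v1 = -1.
Hypothesis qv2 : q v2 = - beta.
Hypothesis beta_neq0 : beta != 0.
Local Notation W := (C0 iota).
Local Notation e := (vsproj (even_part iota) (iota v1 * iota v2)).
Implicit Types (x y a c l : W).

Let two_neq0 : 2%:R != 0 :> F.
Proof. by move: char2; rewrite inE /=. Qed.

Let three_neq0 : 3%:R != 0 :> F.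
Proof. by move: char3; rewrite inE /=. Qed.

Let span x : exists x0 x1 : F, x = x0%:A + x1 *: e.
Proof. exact: (C0P hC bs p12 qv1 qv2). Qed.

Let barE (x0 x1 : F) : bar s (x0%:A + x1 *: e : W) = x0%:A - x1 *: e.
Proof. exact: (barE hC hs bs p12 qv1 qv2). Qed.

Let mulE (x0 x1 y0 y1 : F) : (x0%:A + x1 *: e : W) * (y0%:A + y1 *: e)
  = (x0 * y0 - beta * (x1 * y1))%:A + (x0 * y1 + x1 * y0) *: e.
Proof. exact: (C0M hC bs p12 qv1 qv2). Qed.

Let addE (x0 x1 y0 y1 : F) : (x0%:A + x1 *: e : W) + (y0%:A + y1 *: e)
  = (x0 + y0)%:A + (x1 + y1) *: e.
Proof. by rewrite addrACA -!scalerDl. Qed.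

Let normE x : (Cnorm s x)%:A = x * bar s x.
Proof. exact: (Cnorm_alg hC hs bs p12 qv1 qv2). Qed.

Fact bar_linear : linear (bar s : W -> W).
Proof. by move=> k x y; rewrite /bar !linearP. Qed.

Let barL : {linear W -> W} :=
  HB.pack (bar s) (GRing.isLinear.Build F W W *:%R (bar s) bar_linear).

Let free1e (x0 x1 : F) : x0%:A + x1 *: e = 0 :> W -> x0 = 0 /\ x1 = 0.
Proof.
move=> xe0; have x00 : x0 = 0.
  have := congr1 (bar s) xe0; rewrite barE => cxe0.
  have : (x0 + x0)%:A = 0 :> W.
    have bar0 : bar s 0 = 0 := linear0 barL.
    by rewrite -[RHS]bar0 -[RHS]add0r -[in RHS]cxe0 -xe0 addrACA subrr addr0 -scalerDl.
  move/eqP; rewrite scaler_eq0 oner_eq0 orbF -mulr2n -mulr_natl mulf_eq0.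
  by rewrite (negPf two_neq0) => /eqP.
split=> //; move: xe0; rewrite x00 scale0r add0r => /(congr1 ( *%R^~ e)).
rewrite mul0r -scalerAl (e_sqr hC bs p12 qv1 qv2) scalerA => /eqP.
rewrite scaler_eq0 oner_eq0 orbF mulf_eq0 oppr_eq0 (negPf beta_neq0) orbF.
by move/eqP.
Qed.

Fact C0_mulC : @commutative W W *%R.
Proof.
move=> x y; have [[x0 [x1 ->]] [y0 [y1 ->]]] := (span x, span y).
by rewrite !mulE; congr (_ *: _ + _ *: _); ring.
Qed.

(** C0 with its commutativity, so that ring applies to it. *)
Let A : comUnitAlgType F :=
  HB.pack W (GRing.PzSemiRing_hasCommutativeMul.Build W C0_mulC).

Fact bar_monoid_morphism : monoid_morphism (bar s : A -> A).
Proof.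
split=> [|x y].
  have := barE 1 0; rewrite scale0r subr0 addr0 scale1r; exact.
have [[x0 [x1 ->]] [y0 [y1 ->]]] := (span x, span y).
rewrite !barE -!scaleNr !mulE !barE -scaleNr.
by congr (_ *: _ + _ *: _); ring.
Qed.

Let conj : {rmorphism A -> A} :=
  HB.pack (bar s : A -> A)
    (GRing.isLinear.Build F W W *:%R (bar s) bar_linear)
    (GRing.isMonoidMorphism.Build A A (bar s) bar_monoid_morphism).

Let bar1 : bar s (1 : W) = 1 := rmorph1 conj.

Let basis1e : basis_of fullv [tuple 1 : W; e].
Proof.
have e_line k : 1 <> k *: e :> W.
  move=> h; have [|/eqP] := @free1e 1 (- k); last by rewrite oner_eq0.
  by rewrite scaleNr scale1r h subrr.
rewrite /basis_of free_cons span_seq1 seq1_free; apply/and3P; split.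
- apply/eqP/vspaceP => x; rewrite memvf span_cons span_seq1.
  have [x0 [x1 ->]] := span x.
  by rewrite memv_add // memvZ ?memv_line.
- by apply/negP => /vlineP[k /e_line].
- apply/eqP => e0; have [|_ /eqP] := @free1e 0 1; last by rewrite oner_eq0.
  by rewrite scale0r add0r scale1r e0.
Qed.

Let linfunE (f : W -> W) : linear f -> forall x, linfun f x = f x.
Proof.
move=> f_lin x; pose g : {linear W -> W} :=
  HB.pack f (GRing.isLinear.Build F W W *:%R f f_lin).
exact: (lfunE g).
Qed.

(** * Regularity of F_ac *)

Lemma linear_plane_map (u w : W) : linear (fun x : W => u * x + w * bar s x).
Proof.
by move=> k x y; rewrite bar_linear !mulrDr -!scalerAr scalerDr addrACA.
Qed.

Lemma lfdet_lftr_plane_map (u w : W) (f : W -> W) :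
  (forall x, f x = u * x + w * bar s x) ->
  lfdet (linfun f) = Cnorm s u - Cnorm s w
  /\ (lftr (linfun f))%:A = u + bar s u.
Proof.
move=> /funext ->; set g := linfun _.
have gE x : g x = u * x + w * bar s x by apply/linfunE/linear_plane_map.
have [u0 [u1 uE]] := span u; have [w0 [w1 wE]] := span w.
have g1 : g 1 = (u0 + w0) *: 1 + (u1 + w1) *: e.
  rewrite gE bar1 !mulr1 uE wE; exact: addE.
have ge : g e = (- beta * (u1 - w1)) *: 1 + (u0 - w0) *: e.
  have -> : g e = g (0%:A + 1 *: e) by rewrite scale0r add0r scale1r.
  rewrite gE uE wE barE -scaleNr !mulE addE; congr (_ *: _ + _ *: _); ring.
have [-> ->] := lfdet_lftr_plane basis1e g1 ge.
rewrite uE wE !(CnormE hC hs bs p12 qv1 qv2) barE; split; first by ring.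
by rewrite -scaleNr addE subrr scale0r addr0; congr (_ *: _); ring.
Qed.

Let i : {rmorphism F -> A} := in_alg A.

Let barM x y : bar s (x * y) = bar s x * bar s y := rmorphM conj x y.

Lemma FmapE (a c x y : W) :
  Fmap s a c x y = (a * x) * y + (c * bar s x) * bar s y.
Proof. by rewrite /Fmap barM mulrA. Qed.

Lemma Fmap_symmetric_bilinear (a c : W) : symmetric_bilinear (Fmap s a c).
Proof.
have Fsym x y : Fmap s a c x y = Fmap s a c y x.
  by rewrite /Fmap [x * y]C0_mulC -!mulrA [x * y]C0_mulC.
have Flin x : linear (Fmap s a c x).
  by move=> k y z; rewrite !FmapE linear_plane_map.
by split=> //; split=> [y|x] k u v; rewrite ?[Fmap s a c _ y]Fsym Flin.
Qed.

Lemma trBE (a c x : W) : (trB (Fmap s a c) x)%:A = a * x + bar s (a * x).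
Proof. exact: (lfdet_lftr_plane_map (FmapE a c x)).2. Qed.

(** Writing the traces t(z) = a z + bar (a z) inside the algebra turns the
    traceless part of F_ac into y |-> u y + w bar y, for which the determinant is
    N(u) - N(w). *)
Lemma qB_Bcirc (a c x : W) :
  qB (Bcirc (Fmap s a c)) x
  = Cnorm s (3%:R^-1 *: (a * x - bar s (a * x)))
    - Cnorm s (c * bar s x - 3%:R^-1 *: (bar s a * x)).
Proof.
apply: (lfdet_lftr_plane_map _).1 => y; rewrite /Bcirc /sigma FmapE.
have scaleE k (z : W) : k *: z = i k * z :> A by rewrite mulr_algl.
have third3 : i 3%:R^-1 * 3%:R = 1.
  by rewrite -(rmorph_nat i 3) -rmorphM mulVf ?rmorph1.
have trE z : i (trB (Fmap s a c) z) = a * z + bar s (a * z) by exact: trBE.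
rewrite !scaleE !trE !barM.
move: (bar s a) (bar s x) (bar s y) => a' x' y'.
move: a c x y a' x' y' (i _) third3 {trE}.
change (subvs_of (even_part iota)) with (A : Type).
move=> a c x y a' x' y' k third3.
have -> : (a : A) * x * y = k * 3%:R * (a * x * y) by rewrite third3 mul1r.
ring.
Qed.

Lemma KinvE (a0 a1 c0 c1 : F) :
  Kinv s (a0%:A + a1 *: e) (c0%:A + c1 *: e)
  = 2%:R * (a0 * (a0 ^+ 2 - 3%:R * beta * a1 ^+ 2) * c0
            - beta * a1 * (3%:R * a0 ^+ 2 - beta * a1 ^+ 2) * c1).
Proof.
rewrite /Kinv !barE -!scaleNr !exprS expr0 !mulr1 !mulE addE.
set z := (X in X *: e); have -> : z = 0 by rewrite /z; ring.
by rewrite scale0r addr0 scalar_partE; ring.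
Qed.

(** 9 q_(F°) is the form x |-> P x^2 + bar (P x^2) + M x bar x on W, where
    P = 3 bar a bar c - a^2 and M = N(a) - 9 N(c); the discriminant of such a
    form is M^2 - 4 N(P), up to the factor - 4 beta. *)
Lemma qB_Bcirc_form (a c : W) : exists p r t : F,
  (forall x0 x1 : F, qB (Bcirc (Fmap s a c)) (x0 *: 1 + x1 *: e)
     = p * x0 ^+ 2 + r * (x0 * x1) + t * x1 ^+ 2)
  /\ r ^+ 2 - 4%:R * (p * t) = - (4%:R * beta / 81%:R) *
     (12%:R * Kinv s a c - 3%:R * Cnorm s a ^+ 2
      - 54%:R * Cnorm s a * Cnorm s c + 81%:R * Cnorm s c ^+ 2).
Proof.
have [[a0 [a1 ->]] [c0 [c1 ->]]] := (span a, span c).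
pose P0 := 3%:R * (a0 * c0 - beta * (a1 * c1)) - (a0 ^+ 2 - beta * a1 ^+ 2).
pose P1 := - 3%:R * (a0 * c1 + a1 * c0) - 2%:R * a0 * a1.
pose M := (a0 ^+ 2 + beta * a1 ^+ 2) - 9%:R * (c0 ^+ 2 + beta * c1 ^+ 2).
exists ((2%:R * P0 + M) / 9%:R), (- (4%:R * beta * P1) / 9%:R),
  (beta * (M - 2%:R * P0) / 9%:R).
have nine : 9%:R != 0 :> F by rewrite (natrM _ 3 3) mulf_neq0.
have nine2 : 81%:R != 0 :> F by rewrite (natrM _ 9 9) mulf_neq0.
have oppE (x0 x1 : F) : - (x0%:A + x1 *: e : W) = (- x0)%:A + (- x1) *: e.
  by rewrite opprD !scaleNr.
have scaleE (k x0 x1 : F) : k *: (x0%:A + x1 *: e : W) = (k * x0)%:A + (k * x1) *: e.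
  by rewrite scalerDr !scalerA.
split=> [x0 x1|].
  rewrite qB_Bcirc !mulE !barE -!scaleNr !mulE !scaleE !oppE !addE !scaleE.
  rewrite !(CnormE hC hs bs p12 qv1 qv2) /P0 /P1 /M.
  by field; rewrite nine three_neq0.
by rewrite KinvE !(CnormE hC hs bs p12 qv1 qv2) /P0 /P1 /M; field; rewrite nine nine2.
Qed.

(** Putting N(c) = N(a) + 1 in the discriminant of the form 9 q_(F°) turns it into
    3 Jden, up to the factor - 4 beta. *)
Lemma regular_Fmap (a c : W) : Cnorm s c - Cnorm s a = 1 ->
  regular_map (Fmap s a c) <-> Jden s a c != 0.
Proof.
move=> hac; have [p [r [t [QE disc]]]] := qB_Bcirc_form a c.
have nd := nondegenerate_plane span free1e QE.
have -> : (Jden s a c != 0) = (r ^+ 2 - 4%:R * (p * t) != 0).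
  have Nc : Cnorm s c = Cnorm s a + 1 by rewrite -hac addrC subrK.
  rewrite disc Nc.
  have -> : 12%:R * Kinv s a c - 3%:R * Cnorm s a ^+ 2
      - 54%:R * Cnorm s a * (Cnorm s a + 1) + 81%:R * (Cnorm s a + 1) ^+ 2
    = 3%:R * Jden s a c by rewrite /Jden; ring.
  rewrite !(mulf_eq0, oppr_eq0, invr_eq0) (negPf three_neq0) (negPf beta_neq0).
  by rewrite (natrM _ 2 2) (natrM _ 9 9) (natrM _ 3 3) !mulf_eq0
    (negPf two_neq0) (negPf three_neq0).
split=> [[_ /nd]|/nd ndQ] //; split=> //; exact: Fmap_symmetric_bilinear.
Qed.

(** * The action on the maps F_ac *)

Let N : A -> F := Cnorm s.
Let K : A -> A -> F := Kinv s.

Let eK : (e : A) * e = i (- beta).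
Proof. exact: (e_sqr hC bs p12 qv1 qv2). Qed.

Let span1e (x : A) : exists x0 x1 : F, x = i x0 + i x1 * (e : A).
Proof.
by have [x0 [x1 xE]] := span x; exists x0, x1; rewrite [LHS]xE mulr_algl.
Qed.

Let conj_scalar k : conj (i k) = i k.
Proof. by have := barE k 0; rewrite !scale0r subr0 addr0. Qed.

Let conj_e : conj e = - (e : A).
Proof. by have := barE 0 1; rewrite !scale0r scale1r !add0r. Qed.

Let norm_algE (x : A) : i (N x) = x * conj x.
Proof. exact: normE. Qed.

Let KE (a c : A) : i (K a c) = a ^+ 3 * c + conj a ^+ 3 * conj c.
Proof. exact: (Kinv_alg hC hs bs p12 qv1 qv2). Qed.

Lemma lfun_inv_cancel (g : 'End(W)) (h : W -> W) :
  cancel g h -> cancel h g -> (g^-1)%VF =1 h.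
Proof.
move=> gK hK x; have g0 : lker g == 0%VS by apply/lker0P; exact: can_inj gK.
by rewrite -{1}[x]hK lker0_lfunK.
Qed.

Lemma plane_mapP (u w : W) : exists g : 'End(W), forall x, g x = u * x + w * bar s x.
Proof.
exists (linfun (fun x : W => u * x + w * bar s x)) => x.
exact/linfunE/linear_plane_map.
Qed.

Let barK x : bar s (bar s x) = x := conjK span1e conj_scalar conj_e x.

Let inv_bar l : Cnorm s l = 1 -> l^-1 = bar s l := @norm1_inv _ A i conj N norm_algE l.

Let mul_bar l : Cnorm s l = 1 -> l * bar s l = 1.
Proof. by move=> Nl; rewrite -normE Nl scale1r. Qed.

Let bar_mul l : Cnorm s l = 1 -> bar s l * l = 1.
Proof. by move=> Nl; rewrite C0_mulC mul_bar. Qed.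

Let Fmap_mul (l a c x y : W) : Cnorm s l = 1 ->
  l * Fmap s a c (bar s l * x) (bar s l * y) = Fmap s (l^-1 * a) (l ^+ 3 * c) x y.
Proof.
move=> Nl; rewrite inv_bar // /Fmap !barM barK.
have twist (R : comNzRingType) (k k' u w z z' t t' : R) : k * k' = 1 ->
    k * (u * (k' * z) * (k' * t) + w * ((k * z') * (k * t')))
    = k' * u * z * t + k ^+ 3 * w * (z' * t').
  move=> kk'; have -> : k' * u * z * t = k * k' * (k' * u * z * t).
    by rewrite kk' mul1r.
  by ring.
exact/(twist A)/mul_bar.
Qed.

Lemma act_mul (g : 'End(W)) (l a c : W) :
  Cnorm s l = 1 -> (forall x, g x = l * x) ->
  act_map g (Fmap s a c) = Fmap s (l^-1 * a) (l ^+ 3 * c).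
Proof.
move=> Nl gE; have gV : (g^-1)%VF =1 ( *%R (bar s l)).
  by apply: lfun_inv_cancel => x; rewrite gE mulrA ?bar_mul ?mul_bar ?mul1r.
apply/funext => x; apply/funext => y.
by rewrite /act_map gE !gV Fmap_mul.
Qed.

(** As the inverse of g is g itself, bar is met twice on each argument, and
    only the coefficients of F_ac are conjugated. *)
Lemma act_mul_bar (g : 'End(W)) (l a c : W) :
  Cnorm s l = 1 -> (forall x, g x = l * bar s x) ->
  act_map g (Fmap s a c) = Fmap s (l^-1 * bar s a) (l ^+ 3 * bar s c).
Proof.
move=> Nl gE; have gV : (g^-1)%VF =1 (fun x => l * bar s x).
  apply: lfun_inv_cancel => x; rewrite gE barM barK mulrA.
    by rewrite mul_bar ?mul1r.
  by rewrite mul_bar ?mul1r.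
apply/funext => x; apply/funext => y.
rewrite /act_map gE !gV -Fmap_mul //; congr (_ * _).
have bar_add u w : bar s (u + w) = bar s u + bar s w := raddfD barL u w.
by rewrite /Fmap bar_add !barM !barK.
Qed.

(** * Invariants and orbits *)

(** The denominator D can be recovered from J1 and J2, because the part of D
    which is not a combination of the numerators is the non-zero constant 27. *)
Lemma J_separates (n k n' k' : F) :
  let D m j := 4%:R * j + 8%:R * m ^+ 2 + 36%:R * m + 27%:R in
  let P1 m j := 27%:R * ((j + 2%:R * m ^+ 2 + 3%:R * m) / D m j) in
  let P2 m j := 27%:R * ((j + 2%:R * m ^+ 2) / D m j) in
  D n k != 0 -> D n' k' != 0 ->
  P1 n k = P1 n' k' -> P2 n k = P2 n' k' -> n' = n /\ k' = k.
Proof.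
move=> D P1 P2 D0 D0' eqP1 eqP2.
have n9 : 9%:R != 0 :> F by rewrite (natrM _ 3 3) mulf_neq0.
have n27 : 27%:R != 0 :> F by rewrite (natrM _ 3 9) mulf_neq0.
have n81 : 81%:R != 0 :> F by rewrite (natrM _ 9 9) mulf_neq0.
have recD m j : D m j != 0 ->
    (D m j)^-1 = (1 - 4%:R / 9%:R * P1 m j + 8%:R / 27%:R * P2 m j) / 27%:R.
  by move=> Dm; rewrite /P1 /P2; move: Dm; rewrite /D => Dm; field; rewrite Dm n27 n9.
have eqD : D n k = D n' k' by apply: invr_inj; rewrite !recD // eqP1 eqP2.
have recn m j : D m j != 0 -> m = D m j * (P1 m j - P2 m j) / 81%:R.
  by move=> Dm; rewrite /P1 /P2; move: Dm; rewrite /D => Dm; field; rewrite Dm n81.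
have eqn : n' = n by rewrite (recn _ _ D0) (recn _ _ D0') eqP1 eqP2 eqD.
split=> //; move: eqP2; rewrite /P2 eqD eqn.
move=> /(mulfI n27)/(mulIf (invr_neq0 _)) h.
by apply/esym/(addIr (2%:R * n ^+ 2))/h; rewrite -eqn.
Qed.

Lemma Fmap_inj (a c a' c' : W) : Fmap s a c = Fmap s a' c' -> (a, c) = (a', c').
Proof.
move=> /(congr1 (coefs s)).
by rewrite !(coefsE char2 hC hs bs p12 qv1 qv2 beta_neq0).
Qed.

Lemma equivalent_calGP (a c a' c' : W) :
  equivalent (calG s) (Fmap s a c) (Fmap s a' c') <->
  exists2 l, Cnorm s l = 1 & (a', c') = (l^-1 * a, l ^+ 3 * c)
                            \/ (a', c') = (l^-1 * bar s a, l ^+ 3 * bar s c).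
Proof.
split=> [[g [l Nl [gE|gE]]]|[l Nl [] [-> ->]]].
- by rewrite (act_mul _ _ Nl gE) => /Fmap_inj eq; exists l => //; left.
- by rewrite (act_mul_bar _ _ Nl gE) => /Fmap_inj eq; exists l => //; right.
- have [g gE] := plane_mapP l 0.
  have {}gE x : g x = l * x by rewrite gE mul0r addr0.
  by exists g; [exists l => //; left | rewrite (act_mul _ _ Nl gE)].
- have [g gE] := plane_mapP 0 l.
  have {}gE x : g x = l * bar s x by rewrite gE mul0r add0r.
  by exists g; [exists l => //; right | rewrite (act_mul_bar _ _ Nl gE)].
Qed.

Lemma equivalent_calG0 (a c l : W) : Cnorm s l = 1 ->
  equivalent (calG0 s) (Fmap s a c) (Fmap s (l^-1 * a) (l ^+ 3 * c)).
Proof.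
move=> Nl; have [g gE] := plane_mapP l 0.
have {}gE x : g x = l * x by rewrite gE mul0r addr0.
by exists g; [exists l | rewrite (act_mul _ _ Nl gE)].
Qed.

Lemma invariants_of_twist (a c a' c' : W) :
  (exists2 l, Cnorm s l = 1 & (a', c') = (l^-1 * a, l ^+ 3 * c)
                            \/ (a', c') = (l^-1 * bar s a, l ^+ 3 * bar s c)) ->
  [/\ Cnorm s a' = Cnorm s a, Cnorm s c' = Cnorm s c & Kinv s a' c' = Kinv s a c].
Proof.
have normJ x : Cnorm s (bar s x) = Cnorm s x :=
  norm_conj span1e conj_scalar conj_e norm_algE x.
have KJ x y : Kinv s (bar s x) (bar s y) = Kinv s x y :=
  K_conj span1e conj_scalar conj_e KE x y.
move=> [l Nl].
have normT x : Cnorm s (l^-1 * x) = Cnorm s x /\ Cnorm s (l ^+ 3 * x) = Cnorm s x :=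
  norm_twist conj_scalar norm_algE 3 x Nl.
have KT x y : Kinv s (l^-1 * x) (l ^+ 3 * y) = Kinv s x y :=
  K_twist norm_algE KE x y Nl.
by case=> [] [-> ->]; rewrite ?KT ?KJ !(normT _).1 !(normT _).2 ?normJ //.
Qed.

Lemma J_of_norm_K (a c a' c' : W) :
  Cnorm s a' = Cnorm s a -> Kinv s a' c' = Kinv s a c ->
  J1 s (Fmap s a' c') = J1 s (Fmap s a c) /\ J2 s (Fmap s a' c') = J2 s (Fmap s a c).
Proof.
move=> Na Kac; rewrite !(J1E char2 hC hs bs p12 qv1 qv2 beta_neq0).
by rewrite !(J2E char2 hC hs bs p12 qv1 qv2 beta_neq0) /Jden Na Kac.
Qed.

Lemma Jdomain_calG (g : 'End(W)) (B : W -> W -> W) : calG s g -> Jdomain s B ->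
  [/\ Jdomain s (act_map g B), J1 s (act_map g B) = J1 s B
    & J2 s (act_map g B) = J2 s B].
Proof.
move=> Gg [regB [a [c [hac BE]]]].
have [a' [c' [gB orb]]] : exists a' c', act_map g B = Fmap s a' c' /\
    exists2 l, Cnorm s l = 1 & (a', c') = (l^-1 * a, l ^+ 3 * c)
                              \/ (a', c') = (l^-1 * bar s a, l ^+ 3 * bar s c).
  rewrite BE; case: Gg => l Nl [gE|gE].
    exists (l^-1 * a), (l ^+ 3 * c); rewrite (act_mul _ _ Nl gE).
    by split=> //; exists l => //; left.
  exists (l^-1 * bar s a), (l ^+ 3 * bar s c); rewrite (act_mul_bar _ _ Nl gE).
  by split=> //; exists l => //; right.
have [Na Nc Kac] := invariants_of_twist orb; have [eqJ1 eqJ2] := J_of_norm_K Na Kac.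
have hac' : Cnorm s c' - Cnorm s a' = 1 by rewrite Na Nc.
rewrite gB BE; split; [split; last by exists a', c' | exact: eqJ1 | exact: eqJ2].
apply/(regular_Fmap hac'); rewrite /Jden Na Kac.
by apply/(regular_Fmap hac); rewrite -BE.
Qed.

Lemma J_eqP (a c a' c' : W) :
  Cnorm s c - Cnorm s a = 1 -> Cnorm s c' - Cnorm s a' = 1 ->
  regular_map (Fmap s a c) -> regular_map (Fmap s a' c') ->
  (J1 s (Fmap s a c) = J1 s (Fmap s a' c') /\ J2 s (Fmap s a c) = J2 s (Fmap s a' c'))
  <-> (Cnorm s a' = Cnorm s a /\ Kinv s a' c' = Kinv s a c).
Proof.
move=> hac hac' /(regular_Fmap hac) den /(regular_Fmap hac') den'.
split=> [[]|[Na Kac]]; last by have [-> ->] := J_of_norm_K Na Kac.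
rewrite !(J1E char2 hC hs bs p12 qv1 qv2 beta_neq0).
rewrite !(J2E char2 hC hs bs p12 qv1 qv2 beta_neq0).
exact: J_separates.
Qed.

Lemma twist_of_invariants (a c a' c' : W) :
  Cnorm s c - Cnorm s a = 1 -> Cnorm s c' - Cnorm s a' = 1 -> a != 0 ->
  Cnorm s a' = Cnorm s a -> Kinv s a' c' = Kinv s a c ->
  exists2 l, Cnorm s l = 1 & (a', c') = (l^-1 * a, l ^+ 3 * c)
                            \/ (a', c') = (l^-1 * bar s a, l ^+ 3 * bar s c).
Proof.
exact: (twist_of_norm_K two_neq0 beta_neq0 eK span1e conj_scalar conj_e
  norm_algE KE).
Qed.

Let norm0E : Cnorm s (0 : W) = 0 := norm0 conj_scalar norm_algE.

Lemma not_both_0 (a c : W) :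
  Cnorm s c - Cnorm s a = 1 -> ~ (a = 0 /\ c = 0).
Proof.
by move=> hac [a0 c0]; move/eqP: hac; rewrite a0 c0 subrr eq_sym oner_eq0.
Qed.

(** If a' were non-zero, (a', c') could be moved to (a, c), forcing a' = 0: this
    replaces the implication from N(a') = 0 to a' = 0, false in the split case. *)
Lemma equivalent_a0 (a c a' c' : W) :
  Cnorm s c - Cnorm s a = 1 -> Cnorm s c' - Cnorm s a' = 1 -> a = 0 ->
  Cnorm s a' = Cnorm s a -> Kinv s a' c' = Kinv s a c ->
  a' = 0
  /\ (equivalent (calG s) (Fmap s a c) (Fmap s a' c')
      <-> (exists m, c' / c = m ^+ 3) \/ (exists m, c' / bar s c = m ^+ 3)).
Proof.
move=> hac hac' a0 Na Kac.
have bar0 : bar s (0 : W) = 0 := raddf0 conj.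
have a'0 : a' = 0.
  apply/eqP/negPn/negP => a'n0.
  have [l Nl] := twist_of_invariants hac' hac a'n0 (esym Na) (esym Kac).
  have ul : l^-1 \is a GRing.unit by rewrite unitrV (unit_of_norm1 norm_algE Nl).
  case=> [] [aE _]; move: aE; rewrite a0 => /esym.
    by rewrite -(mulr0 l^-1) => /(mulrI ul); move/eqP: a'n0.
  rewrite -(mulr0 l^-1) => /(mulrI ul) /(congr1 (bar s)); rewrite barK bar0.
  by move/eqP: a'n0.
split=> //.
have Nc : Cnorm s c = 1 by rewrite -hac a0 norm0E subr0.
have Nc' : Cnorm s c' = 1 by rewrite -hac' a'0 norm0E subr0.
have Nbc : Cnorm s (bar s c) = 1.
  by rewrite -Nc; exact: (norm_conj span1e conj_scalar conj_e norm_algE).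
have cubeP d : Cnorm s d = 1 ->
    (exists2 l, Cnorm s l = 1 & c' = l ^+ 3 * d) <-> (exists m, c' / d = m ^+ 3).
  by move=> Nd; exact: (norm1_ratio_cube conj_scalar norm_algE Nd Nc').
rewrite equivalent_calGP a0 a'0 bar0; split.
  move=> [l Nl]; rewrite !mulr0; case=> [] [cE].
    by left; apply/(cubeP _ Nc); exists l.
  by right; apply/(cubeP _ Nbc); exists l.
case=> [/(cubeP _ Nc)|/(cubeP _ Nbc)] [l Nl cE]; exists l => //; rewrite !mulr0 cE.
  by left.
by right.
Qed.

(** By twist_of_norm_K, c' is a multiple of c or bar c, so c' = 0. Then
    a'^3 c' = a^3 c holds without conjugating, which is why maps of the form
    x |-> l x suffice. *)
Lemma equivalent_c0 (a c a' c' : W) :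
  Cnorm s c - Cnorm s a = 1 -> Cnorm s c' - Cnorm s a' = 1 -> c = 0 ->
  Cnorm s a' = Cnorm s a -> Kinv s a' c' = Kinv s a c ->
  c' = 0 /\ equivalent (calG0 s) (Fmap s a c) (Fmap s a' c').
Proof.
move=> hac hac' c0 Na Kac.
have a0 : a != 0 by apply/eqP => a0; case: (not_both_0 hac).
have bar0 : bar s (0 : W) = 0 := raddf0 conj.
have c'0 : c' = 0.
  by have [l _ [] [_ ->]] := twist_of_invariants hac hac' a0 Na Kac; rewrite c0 ?bar0 mulr0.
have eqy : (a' : A) ^+ 3 * c' = a ^+ 3 * c by rewrite c0 c'0 !mulr0.
have [l Nl [-> ->]] := twist_of_cube two_neq0 beta_neq0 eK span1e conj_scalar conj_e
  norm_algE hac hac' Na a0 eqy.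
by split; [rewrite c0 mulr0 | exact: equivalent_calG0].
Qed.

End EvenClifford.

Theorem proposition6p1
  (F : fieldType) (char2 : 2%N \notin [pchar F]) (char3 : 3%N \notin [pchar F])
  (V : vectType F) (dimV : \dim {:V} = 2%N)
  (q : V -> F) (hq : quadratic_form q) (hq_nd : nondegenerate_qf q)
  (hq1 : exists v, q v = -1)
  (C : falgType F) (iota : 'Hom(V, C))
  (hC : clifford_algebra (fun v => - q v) iota)
  (s : 'End(C)) (hs : clifford_conjugation iota s)
  (a c a' c' : C0 iota)
  (hac : Cnorm s c - Cnorm s a = 1) (hac' : Cnorm s c' - Cnorm s a' = 1)
  (hreg : regular_map (Fmap s a c)) (hreg' : regular_map (Fmap s a' c')) :
  [/\ (* invariance *)
      ((exists2 l : C0 iota, Cnorm s l = 1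
          & (a', c') = (l^-1 * a, l ^+ 3 * c)
            \/ (a', c') = (l^-1 * bar s a, l ^+ 3 * bar s c)) ->
       J1 s (Fmap s a c) = J1 s (Fmap s a' c')
       /\ J2 s (Fmap s a c) = J2 s (Fmap s a' c'))
      /\ (forall (g : 'End(C0 iota)) (B : C0 iota -> C0 iota -> C0 iota),
           calG s g -> Jdomain s B ->
           [/\ Jdomain s (act_map g B), J1 s (act_map g B) = J1 s B
             & J2 s (act_map g B) = J2 s B]),
      (* separation by (i) and (ii) *)
      (J1 s (Fmap s a c) = J1 s (Fmap s a' c')
       /\ J2 s (Fmap s a c) = J2 s (Fmap s a' c'))
      <-> (Cnorm s a' = Cnorm s a /\ Kinv s a' c' = Kinv s a c)
    & (* the mutually excluding cases *)
      [/\ ~ (a = 0 /\ c = 0),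
          a = 0 -> Cnorm s a' = Cnorm s a -> Kinv s a' c' = Kinv s a c ->
          a' = 0
          /\ (equivalent (calG s) (Fmap s a c) (Fmap s a' c')
              <-> (exists m, c' / c = m ^+ 3) \/ (exists m, c' / bar s c = m ^+ 3)),
          c = 0 -> Cnorm s a' = Cnorm s a -> Kinv s a' c' = Kinv s a c ->
          c' = 0 /\ equivalent (calG0 s) (Fmap s a c) (Fmap s a' c')
        & a != 0 -> c != 0 ->
          (Cnorm s a' = Cnorm s a /\ Kinv s a' c' = Kinv s a c
           <-> equivalent (calG s) (Fmap s a c) (Fmap s a' c'))]].
Proof.
have [v1 [v2 [beta [bs p12 qv1 qv2 beta0]]]] :=
  orthogonal_basis char2 dimV hq hq_nd hq1.
have sep := J_eqP char2 char3 hC hs bs p12 qv1 qv2 beta0 hac hac' hreg hreg'.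
have orb := @invariants_of_twist _ _ _ _ _ _ _ _ _ hC hs bs p12 qv1 qv2 a c a' c'.
have equivP := @equivalent_calGP _ _ _ _ _ _ _ _ _ char2 hC hs bs p12 qv1 qv2 beta0 a c a' c'.
split; first split.
- by move=> /orb[Na _ Kac]; apply/sep.
- exact: (Jdomain_calG char2 char3 hC hs bs p12 qv1 qv2 beta0).
- exact: sep.
split.
- exact: (not_both_0 hac).
- exact: (equivalent_a0 char2 hC hs bs p12 qv1 qv2 beta0 hac hac').
- exact: (equivalent_c0 char2 hC hs bs p12 qv1 qv2 beta0 hac hac').
- move=> a0 _; rewrite equivP; split=> [[Na Kac]|/orb[Na _ Kac]] //.
  exact: (twist_of_invariants char2 hC hs bs p12 qv1 qv2 beta0 hac hac' a0).
Qed.
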